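(* Let $\mathcal{C}$ be a root class of groups and let $G$ be the free product of a family of residually $\mathcal{C}$-groups $A_i$ ($i \in \mathcal{I}$). Then a cyclic subgroup $H$ of $G$ is $\mathcal{C}$-defective in $G$ if and only if $H$ is conjugate in $G$ to a cyclic subgroup $H'$ of $A_i$ for some $i \in \mathcal{I}$ such that $H'$ is $\mathcal{C}$-defective in the group $A_i$. In particular, if for every $i \in \mathcal{I}$ all $\mathfrak{P}(\mathcal{C})'$-isolated cyclic subgroups of $A_i$ are $\mathcal{C}$-separable in $A_i$, then all $\mathfrak{P}(\mathcal{C})'$-isolated cyclic subgroups of $G$ are $\mathcal{C}$-separable in $G$.
   Context: Classes of groups are, as usual, closed under isomorphism. A class of groups $\mathcal{C}$ is a root class if it contains non-trivial groups and is closed under taking subgroups and unrestricted wreath products (the unrestricted wreath product of $X$ and $Y$ is the semidirect product of the full Cartesian power $X^Y$ by $Y$, with $Y$ acting by permuting coordinates via translation). A subgroup $Y$ of a group $X$ is $\mathcal{C}$-separable in $X$ if for any $x \in X \setminus Y$ there is a homomorphism $\sigma$ of $X$ onto a group from $\mathcal{C}$ with $x\sigma \notin Y\sigma$. A group $X$ is residually a $\mathcal{C}$-group (a residually $\mathcal{C}$-group) if its trivial subgroup is $\mathcal{C}$-separable in $X$. $\mathfrak{P}(\mathcal{C})$ is the following set of primes: if $\mathcal{C}$ contains a non-periodic group, it is the set of all primes; otherwise, a prime $p$ belongs to it if and only if $p$ divides the order of an element of some group in $\mathcal{C}$. A subgroup $Y$ of $X$ is $\mathfrak{P}(\mathcal{C})'$-isolated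 in $X$ if for each $x \in X$ and each prime $q \notin \mathfrak{P}(\mathcal{C})$, $x^q \in Y$ implies $x \in Y$. A subgroup of $X$ is $\mathcal{C}$-defective in $X$ if it is $\mathfrak{P}(\mathcal{C})'$-isolated in $X$ but not $\mathcal{C}$-separable in $X$. Free products are ordinary free products, and the free factors are regarded as subgroups of the free product. *)

(* Defs.v *)
From HB Require Import structures.
From mathcomp Require Import all_boot.
From mathcomp Require Import boolp classical_sets.

Set Implicit Arguments.
Unset Strict Implicit.
Unset Printing Implicit Defensive.

Local Open Scope classical_set_scope.
Local Open Scope group_scope.

Notation "{ 'hom' G -> H }" := (UMagmaMorphism.type G%type H%type)
  (at level 0, G at level 98, H at level 99,
   format "{ 'hom'  G  ->  H }") : type_scope.

(** Unrestricted wreath product: [y f] with [y] in [Y] and [f] in the full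
    Cartesian power [X^Y] is stored as [Wreath y f]; [Y] acts on [X^Y] on the
    right by [f^y (t) = f (t y^-1)], and [(y f) (z g) = (y z) (f^z g)]. *)
Record wreath (X Y : groupType) : Type := Wreath { wtop : Y; wbase : Y -> X }.

HB.instance Definition _ (X Y : groupType) := gen_eqMixin (wreath X Y).
HB.instance Definition _ (X Y : groupType) := gen_choiceMixin (wreath X Y).

Section WreathGroup.
Variables X Y : groupType.
Implicit Types (f g : Y -> X) (u v w : wreath X Y).

Definition translate f (y : Y) : Y -> X := fun t => f (t * y^-1).

Definition wreath_mul u v :=
  Wreath (wtop u * wtop v)
         (fun t => translate (wbase u) (wtop v) t * wbase v t).

Definition wreath_one : wreath X Y := Wreath 1 (fun=> 1).

Definition wreath_inv u :=
  Wreath (wtop u)^-1 (fun t => (translate (wbase u) (wtop u)^-1 t)^-1).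

Lemma wreath_mulA : associative wreath_mul.
Proof.
case=> x f [y g] [z h]; rewrite /wreath_mul /translate /= mulgA.
by congr Wreath; apply/funext => t; rewrite invgM !mulgA.
Qed.

Lemma wreath_mul1 : left_id wreath_one wreath_mul.
Proof.
case=> x f; rewrite /wreath_mul /translate /= mul1g.
by congr Wreath; apply/funext => t; rewrite mul1g.
Qed.

Lemma wreath_mulr1 : right_id wreath_one wreath_mul.
Proof.
case=> x f; rewrite /wreath_mul /translate /= mulg1.
by congr Wreath; apply/funext => t; rewrite invg1 !mulg1.
Qed.

Lemma wreath_mulV : left_inverse wreath_one wreath_inv wreath_mul.
Proof.
case=> x f; rewrite /wreath_mul /wreath_inv /translate /= mulVg.
by congr Wreath; apply/funext => t; rewrite invgK mulgVK mulVg.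
Qed.

Lemma wreath_mulrV : right_inverse wreath_one wreath_inv wreath_mul.
Proof.
case=> x f; rewrite /wreath_mul /wreath_inv /translate /= mulgV.
by congr Wreath; apply/funext => t; rewrite mulgV.
Qed.

End WreathGroup.

HB.instance Definition _ (X Y : groupType) :=
  isGroup.Build (wreath X Y) (@wreath_mulA X Y) (@wreath_mul1 X Y)
    (@wreath_mulr1 X Y) (@wreath_mulV X Y) (@wreath_mulrV X Y).

Definition isomorphic (X Y : groupType) : Prop :=
  exists f : {hom X -> Y}, bijective f.

(** A class of groups is a predicate on [groupType]; [isom_closed] below makes
    it independent of the choice structure carried by a [groupType]. *)
Definition isom_closed (C : groupType -> Prop) : Prop :=
  forall X Y : groupType, isomorphic X Y -> C X -> C Y.

Definition root_class (C : groupType -> Prop) : Prop :=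
  [/\ isom_closed C,
      (exists2 X : groupType, C X & exists x : X, x <> 1),
      (forall (X : groupType) (S : pred X) (Y : subGroupType S), C X -> C Y)
    & (forall X Y : groupType, C X -> C Y -> C (wreath X Y))].

Definition cyclic_gen (X : groupType) (a : X) : set X :=
  [set x | exists n : nat, x = a ^+ n \/ x = a ^- n].

Definition cyclic_subgroup (X : groupType) (H : set X) : Prop :=
  exists a : X, H = cyclic_gen a.

Definition conjugate_in (X : groupType) (H K : set X) : Prop :=
  exists g : X, H = [set x ^ g | x in K].

Definition separable (C : groupType -> Prop) (X : groupType) (Y : set X) :
    Prop :=
  forall x : X, ~ Y x ->
    exists (K : groupType) (sigma : {hom X -> K}),
      [/\ C K, range sigma = setT & ~ (sigma @` Y) (sigma x)].

Definition residually (C : groupType -> Prop) (X : groupType) : Prop :=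
  separable C [set 1 : X].

Definition has_order (X : groupType) (x : X) (n : nat) : Prop :=
  [/\ (0 < n)%N, x ^+ n = 1
    & forall m : nat, (0 < m)%N -> x ^+ m = 1 -> (n <= m)%N].

Definition periodic (X : groupType) : Prop :=
  forall x : X, exists n : nat, has_order x n.

Definition prime_set (C : groupType -> Prop) (p : nat) : Prop :=
  prime p /\
  ((exists2 X : groupType, C X & ~ periodic X) \/
   (exists (X : groupType) (x : X) (n : nat),
      [/\ C X, has_order x n & (p %| n)%N])).

Definition isolated (C : groupType -> Prop) (X : groupType) (Y : set X) :
    Prop :=
  forall (x : X) (q : nat), prime q -> ~ prime_set C q -> Y (x ^+ q) -> Y x.

Definition defective (C : groupType -> Prop) (X : groupType) (Y : set X) :
    Prop :=
  isolated C Y /\ ~ separable C Y.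

(** [G] with the homomorphisms [iota i] is the coproduct of the [A i] in the
    category of groups; injectivity of each [iota i] follows, and the free
    factor [A i] is regarded as the subgroup [range (iota i)] of [G]. *)
Definition free_product (I : Type) (A : I -> groupType) (G : groupType)
    (iota : forall i : I, {hom A i -> G}) : Prop :=
  forall (T : groupType) (f : forall i : I, {hom A i -> T}),
    exists2 h : {hom G -> T},
      (forall (i : I) (a : A i), h (iota i a) = f i a)
    & (forall h' : {hom G -> T},
         (forall (i : I) (a : A i), h' (iota i a) = f i a) -> h' =1 h).

(* Main.v *)
From HB Require Import structures.
Require Import Defs.
From mathcomp Require Import all_boot.
From mathcomp Require Import boolp classical_sets.

(** The proof rests on one wreath product construction and on normal forms.

    Let [f] map the free product [G] to a group [L], and let [w] be a word
    whose first and last letters come from different factors, killed by [f]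
    although no proper suffix of [w] is.  Inside the wreath product of [K] by
    [L], conjugate the copy of [L] that receives the factor of the first letter
    by a function supported at [1], and send the other factors to the standard
    copy.  The universal property gives a lift of [f]; while [w] is read, the
    path traced in [L] meets [1] only at its two ends, and the end that touches
    the last letter contributes nothing.  So [w] is sent to a base function
    whose value at [1] is a prescribed element of [K] ([wreath_lift]).

    This is used twice.  With any nontrivial [K], induction on the length shows
    that a nonempty reduced word survives in some group of the class
    ([reduced_detected]); hence reduced words are normal forms
    ([reduced_inj]) and [G] is residually in the class.  With a [K] that has an
    element of infinite order or of order divisible by [p], iteration makes the
    order of the image of a primitive cyclically reduced word infinite or
    divisible by any given power of [p] ([power_detected]).

    An element of [G] is trivial, conjugate into a factor, or conjugate to the
    value of a cyclically reduced word [c].  In the third case an isolated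
    [<c>] is separable ([hyperbolic_separable]): an element [g] that does not
    commute with [c] is separated by detecting their commutator; if it does
    commute, then normal forms show that [c] or its inverse is [rho^M] and
    [g = rho^n] for a primitive [rho] ([commuting_root]), some prime power
    [p^k] divides [M] but not [n], isolation puts [p] in the prime set of the
    class, and [power_detected] separates.

    For a subgroup of a factor, the retraction of [G] onto that factor carries
    separability over to [G] ([separable_factor]); isolation carries over
    because, for a prime [q] outside the prime set, [q]-th roots in a
    residually-[C] group are unique ([isolated_factor]). *)

Set Implicit Arguments.
Unset Strict Implicit.
Unset Printing Implicit Defensive.

Local Open Scope classical_set_scope.
Local Open Scope group_scope.

(** * Subgroups and wreath products *)

Section SubgroupTypes.
Variables (X : groupType) (S : pred X) (closedS : group_closed S).

(** The closure proof is a parameter so that the group structure can be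
    attached to this type. *)
Definition subgroup_of of group_closed S := {x : X | S x}.
Local Notation subX := (subgroup_of closedS).

HB.instance Definition _ := SubChoice.copy subX {x : X | S x}.
HB.instance Definition _ := SubChoice_isSubGroup.Build X S subX closedS.

Section Corestriction.
Variables (G : groupType) (f : {hom G -> X}) (Sf : forall g, S (f g)).

Definition corestriction (g : G) : subX := Sub (f g) (Sf g).

Fact corestriction_morph : monoid_morphism corestriction.
Proof.
split=> [|x y]; apply: val_inj => /=; first exact: gmulf1.
exact: gmulfM.
Qed.

HB.instance Definition _ :=
  isUMagmaMorphism.Build G subX corestriction corestriction_morph.

End Corestriction.
End SubgroupTypes.

Section Homs.
Variables (X K L : groupType).

(** The diagonal copy of [K] commutes with [L] in the wreath product, so two
    homomorphisms are combined without leaving a class closed under wreath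
    products. *)
Definition const_wreath (f : {hom X -> K}) (g : {hom X -> L}) (x : X) :
  wreath K L := Wreath (g x) (fun=> f x).

Fact const_wreath_morph f g : monoid_morphism (const_wreath f g).
Proof.
split=> [|x y]; first by rewrite /const_wreath !gmulf1.
by rewrite /const_wreath !gmulfM.
Qed.

HB.instance Definition _ f g :=
  isUMagmaMorphism.Build X (wreath K L) (const_wreath f g)
    (const_wreath_morph f g).

Fact wtop_morph : monoid_morphism (@wtop K L).
Proof. by []. Qed.

HB.instance Definition _ :=
  isUMagmaMorphism.Build (wreath K L) L (@wtop K L) wtop_morph.

(** The complements of the base group obtained from [L] by conjugating with
    base functions: the freedom from which all lifts to wreath products come. *)
Definition twisted_top (f : L -> K) (y : L) : wreath K L :=
  Wreath y (fun=> 1) ^ Wreath 1 f.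

Arguments twisted_top : simpl never.

Fact twisted_top_morph f : monoid_morphism (twisted_top f).
Proof.
split=> [|x y]; first exact: conj1g.
rewrite /twisted_top -conjMg; congr (_ ^ _).
by congr Wreath; apply/funext => t; rewrite /translate mulg1.
Qed.

HB.instance Definition _ f :=
  isUMagmaMorphism.Build L (wreath K L) (twisted_top f) (twisted_top_morph f).

Lemma twisted_topE f y :
  twisted_top f y = Wreath y (fun t => (f (t * y^-1))^-1 * f t).
Proof.
congr Wreath; rewrite /= /translate /= ?invg1 ?mul1g ?mulg1 //.
by apply/funext => t; rewrite mulg1 mul1g.
Qed.

Lemma wreath_exp_base (u : wreath K L) n (t : L) :
  wtop u = 1 -> wbase (u ^+ n) t = wbase u t ^+ n.
Proof.
move=> u1; elim: n => // n IHn.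
rewrite expgSr [RHS]expgSr -IHn /= /translate.
by rewrite u1 invg1 mulg1.
Qed.

End Homs.

(** * Element orders, conjugation and cyclic subgroups *)

Lemma has_order_dvd (X : groupType) (x : X) n t :
  has_order x n -> x ^+ t = 1 -> (n %| t)%N.
Proof.
case=> n0 xn nmin; rewrite {1}(divn_eq t n) expgnDr mulnC expgnA xn expg1n mul1g.
move=> xt; rewrite /dvdn; case: posnP => // t0.
by move: (nmin _ t0 xt); rewrite leqNgt ltn_mod n0.
Qed.

Lemma has_order_ex (X : groupType) (x : X) t :
  (0 < t)%N -> x ^+ t = 1 -> exists n, has_order x n.
Proof.
move=> t0 xt; have ex: exists n, (0 < n)%N && (x ^+ n == 1).
  by exists t; rewrite t0 xt eqxx.
exists (ex_minn ex); case: ex_minnP => n /andP[n0 /eqP xn] nmin.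
by split=> // m m0 xm; apply: nmin; rewrite m0 xm eqxx.
Qed.

Section Conjugation.
Variables (X : groupType) (g : X).

Definition conjugation (x : X) : X := x ^ g.

Fact conjugation_morph : monoid_morphism conjugation.
Proof. by split=> [|x y]; rewrite /conjugation ?conj1g ?conjMg. Qed.

HB.instance Definition _ :=
  isUMagmaMorphism.Build X X conjugation conjugation_morph.

End Conjugation.

Lemma conjugate_in_sym (X : groupType) (H K : set X) :
  conjugate_in H K -> conjugate_in K H.
Proof.
case=> g ->; exists g^-1; apply/seteqP; split=> [x Kx | _ [_ [x Kx <-] <-]].
  by exists (x ^ g); [exists x | rewrite conjgK].
by rewrite conjgK.
Qed.

Lemma conjugate_in_preimage (X : groupType) (H K : set X) :
  conjugate_in H K -> exists f : {hom X -> X}, H = f @^-1` K.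
Proof.
case=> g ->; exists (conjugation g^-1).
apply/seteqP; split=> [_ [x Kx <-] | x Kx] /=; first by rewrite /conjugation conjgK.
by exists (x ^ g^-1); rewrite // conjgKV.
Qed.

Lemma cyclic_genV (X : groupType) (a : X) : cyclic_gen a^-1 = cyclic_gen a.
Proof.
apply/seteqP; split=> _ [n [->|->]]; exists n; rewrite expVgn ?invgK;
  by [left | right].
Qed.

Lemma cyclic_gen1 (X : groupType) : cyclic_gen (1 : X) = [set 1].
Proof.
apply/seteqP; split=> [_ [n [->|->]] | _ ->] /=; rewrite ?expg1n ?invg1 //.
by exists 0%N; left.
Qed.

Lemma image_cyclic_gen (X Z : groupType) (f : {hom X -> Z}) (a : X) :
  f @` cyclic_gen a = cyclic_gen (f a).
Proof.
apply/seteqP; split=> [_ [_ [n [->|->]] <-] | _ [n [->|->]]].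
- by exists n; left; rewrite gmulfXn.
- by exists n; right; rewrite gmulfXVn.
- by exists (a ^+ n); [exists n; left | rewrite gmulfXn].
- by exists (a ^- n); [exists n; right | rewrite gmulfXVn].
Qed.

Lemma cyclic_gen_conj (X : groupType) (a g : X) :
  cyclic_gen (a ^ g) = [set x ^ g | x in cyclic_gen a].
Proof. by rewrite -(image_cyclic_gen (conjugation g)). Qed.

(** * Detection in a root class *)

Section RootClass.
Variable C : groupType -> Prop.
Hypothesis rootC : root_class C.

(** Closure under subgroups makes surjectivity in the definition of
    separability harmless. *)
Lemma hom_onto_image (G K : groupType) (f : {hom G -> K}) : C K ->
  exists (L : groupType) (s : {hom G -> L}) (j : L -> K),
    [/\ C L, range s = setT & forall g, j (s g) = f g].
Proof.
case: rootC => _ _ subC _ CK.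
pose S : pred K := fun x => `[< exists g, f g = x >].
have closedS : group_closed S.
  split=> [|x y /asboolP[a <-] /asboolP[b <-]]; apply/asboolP.
    by exists 1; rewrite gmulf1.
  by exists (a / b); rewrite gmulfF.
have Sf g : S (f g) by apply/asboolP; exists g.
exists (subgroup_of closedS), (corestriction closedS Sf), val.
split=> //; first exact: (subC K S).
apply/seteqP; split=> // y _; have /asboolP[g fg] := valP y.
by exists g => //; apply: val_inj.
Qed.

Lemma separable_hom (X : groupType) (Y : set X) :
  (forall x, ~ Y x ->
     exists (K : groupType) (f : {hom X -> K}), C K /\ ~ (f @` Y) (f x)) ->
  separable C Y.
Proof.
move=> sepY x /sepY[K [f [CK nYx]]].
have [L [s [j [CL s_onto js]]]] := hom_onto_image f CK.
exists L, s; split=> // -[y Yy sy]; apply: nYx; exists y => //.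
by rewrite -!js sy.
Qed.

Lemma separable_preimage (X Z : groupType) (f : {hom X -> Z}) (Y : set Z) :
  separable C Y -> separable C (f @^-1` Y).
Proof.
move=> sepY; apply: separable_hom => x /sepY[K [s [CK _ nYx]]].
exists K, (s \o f); split=> // -[y Yy sy].
by apply: nYx; exists (f y).
Qed.

Lemma isolated_preimage (X Z : groupType) (f : {hom X -> Z}) (Y : set Z) :
  isolated C Y -> isolated C (f @^-1` Y).
Proof. by move=> isoY x q pr_q nCq; rewrite /= gmulfXn; exact: isoY. Qed.

Lemma separable_conjugate (X : groupType) (H K : set X) :
  conjugate_in H K -> separable C K -> separable C H.
Proof. by case/conjugate_in_preimage=> f ->; exact: separable_preimage. Qed.

Lemma isolated_conjugate (X : groupType) (H K : set X) :
  conjugate_in H K -> isolated C K -> isolated C H.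
Proof. by case/conjugate_in_preimage=> f ->; exact: isolated_preimage. Qed.

Definition detected (X : groupType) (x : X) : Prop :=
  exists (K : groupType) (f : {hom X -> K}), C K /\ f x <> 1.

Lemma residually_detected (X : groupType) (x : X) :
  residually C X -> x <> 1 -> detected x.
Proof.
move=> resX /resX[K [f [CK _ nfx]]]; exists K, f; split=> // fx.
by apply: nfx; exists 1; rewrite ?gmulf1.
Qed.

Lemma detected_residually (X : groupType) :
  (forall x : X, x <> 1 -> detected x) -> residually C X.
Proof.
move=> detX; apply: separable_hom => x /detX[K [f [CK fx]]].
by exists K, f; split=> // -[_ -> ]; rewrite gmulf1 => /esym.
Qed.

Lemma detected_conj (X : groupType) (x y : X) :
  detected x -> detected (x ^ y).
Proof.
case=> K [f [CK fx]]; exists K, f; split=> //.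
by rewrite gmulfJ => /eqP; rewrite conjg_eq1 => /eqP.
Qed.

(** Finitely many elements are detected simultaneously, by combining their
    homomorphisms in a wreath product. *)
Lemma detected_all (X : groupType) (s : seq X) :
  (forall x, x \in s -> detected x) ->
  exists (K : groupType) (f : {hom X -> K}),
    C K /\ forall x, x \in s -> f x <> 1.
Proof.
case: rootC => _ [K0 CK0 _] _ wrC.
elim: s => [|x s IHs] det_s; first by exists K0, (one_fun K0).
have [y ys|K [f [CK fs]]] := IHs; first by apply: det_s; rewrite inE ys orbT.
have [L [h [CL hx]]] := det_s x (mem_head _ _).
exists (wreath L K), (const_wreath h f); split; first exact: wrC.
move=> y; rewrite inE => /predU1P[-> | /fs fy] [] // _.
by move/(congr1 (@^~ 1)).
Qed.

(** A prime outside the prime set forces every group of the class to be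
    periodic without elements of order divisible by [q]; then [x] and [y] are
    the same power of their common [q]-th power. *)
Lemma unique_roots_in_class (K : groupType) (x y : K) (q : nat) :
  C K -> prime q -> ~ prime_set C q -> x ^+ q = y ^+ q -> x = y.
Proof.
move=> CK pr_q nCq xy.
have order_coprime (z : K) : exists n, has_order z n /\ coprime q n.
  have perK : periodic K.
    by apply: contrapT => nper; apply: nCq; split=> //; left; exists K.
  have [n zn] := perK z; exists n; split=> //.
  rewrite prime_coprime //; apply/negP => qn; apply: nCq; split=> //.
  by right; exists K, z, n.
have [n [[n0 xn _] qn]] := order_coprime x.
have [m [[m0 ym _] qm]] := order_coprime y.
have := coprimeMr q n m; rewrite qn qm.
case/(coprimeP _ (prime_gt0 pr_q)) => -[a b] /= ab1.
have {}ab1 : (q * a = 1 + b * (n * m))%N.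
  by rewrite mulnC -ab1 subnK // ltnW // -subn_gt0 ab1.
(* As [q * a] is congruent to [1] modulo both orders, raising to the power [a]
   inverts raising to the power [q]. *)
have powK (z : K) : z ^+ (n * m) = 1 -> z = z ^+ q ^+ a.
  move=> z1; rewrite -expgnA ab1 expgnDr [(b * _)%N]mulnC expgnA z1.
  by rewrite expg1n mulg1.
rewrite (powK x) 1?(powK y) ?xy //.
  by rewrite mulnC expgnA ym expg1n.
by rewrite expgnA xn expg1n.
Qed.

Lemma unique_roots_residually (X : groupType) (x y : X) (q : nat) :
  residually C X -> prime q -> ~ prime_set C q -> x ^+ q = y ^+ q -> x = y.
Proof.
move=> resX pr_q nCq xy; apply: contrapT => nxy.
have [|K [f [CK fxy]]] := @residually_detected X (x / y) resX.
  by move/divg1_eq.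
apply: fxy; rewrite gmulfF; apply/eqP; rewrite divg_eq1; apply/eqP.
by apply: (unique_roots_in_class CK pr_q nCq); rewrite -!gmulfXn xy.
Qed.

End RootClass.

(** * Powers of words *)

Section WordPowers.
Variable T : Type.
Implicit Types (r u v c : seq T) (m n k : nat).

Definition wpow r n := flatten (nseq n r).

Lemma wpowD r m n : wpow r (m + n) = wpow r m ++ wpow r n.
Proof. by rewrite /wpow nseqD flatten_cat. Qed.

Lemma wpow1 r : wpow r 1 = r.
Proof. by rewrite /wpow /= cats0. Qed.

Lemma wpowS r n : wpow r n.+1 = r ++ wpow r n.
Proof. by []. Qed.

Lemma wpowSr r n : wpow r n.+1 = wpow r n ++ r.
Proof. by rewrite -addn1 wpowD wpow1. Qed.

Lemma wpowM r m n : wpow r (m * n) = wpow (wpow r m) n.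
Proof. by elim: n => [|n IHn]; rewrite ?muln0 // mulnS wpowD IHn. Qed.

Lemma size_wpow r n : size (wpow r n) = (n * size r)%N.
Proof. by elim: n => // n IHn; rewrite wpowS size_cat IHn mulSn. Qed.

(** The Euclidean algorithm on lengths: the shorter word is a prefix of the
    longer one, and the remaining factor still commutes with it. *)
Lemma commuting_words u v : u ++ v = v ++ u ->
  exists r m n, u = wpow r m /\ v = wpow r n.
Proof.
move: {2}(size u + size v).+1 (ltnSn (size u + size v)) => N.
elim: N => // N IHN in u v *; wlog le_uv: u v / (size u <= size v)%N.
  move=> H; case: (leqP (size u) (size v)) => [|/ltnW] le lt_N uv; first exact: H.
  by have [||r [m [n [-> ->]]]] := H v u le; [rewrite addnC | | exists r, n, m].
case: u => [|x u] in le_uv *.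
  by move=> _ _; exists v, 0%N, 1%N; rewrite wpow1.
move=> lt_N uv; have [w def_v] : exists w, v = (x :: u) ++ w.
  exists (drop (size (x :: u)) v).
  have := congr1 (take (size (x :: u))) uv.
  by rewrite take_size_cat // takel_cat // => {1}->; rewrite cat_take_drop.
have [||r [m [n [def_u def_w]]]] := IHN (x :: u) w.
- rewrite -ltnS; apply: leq_trans lt_N.
  rewrite def_v !size_cat /= !addSn !addnS !ltnS.
  by rewrite addnA leq_add2r leq_addl.
- move: uv; rewrite def_v -!catA => /(congr1 (drop (size (x :: u)))).
  by rewrite !drop_size_cat.
by exists r, m, (m + n)%N; split=> //; rewrite def_v def_w wpowD -def_u.
Qed.

Lemma wpow_suffix r n u v : wpow r n = u ++ v -> u <> [::] ->
  exists r1 r2 j,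
    [/\ r = r1 ++ r2, r1 <> [::], v = r2 ++ wpow r j & (j < n)%N].
Proof.
elim: n u => [|n IHn] u; first by case: u.
rewrite wpowS => def_uv u_neq0; case: (leqP (size u) (size r)) => [le_ur|lt_ru].
  have def_r : r = u ++ drop (size u) r.
    have := congr1 (take (size u)) def_uv.
    by rewrite takel_cat // take_size_cat // => {1}<-; rewrite cat_take_drop.
  exists u, (drop (size u) r), n; split=> //.
  move: def_uv; rewrite {1}def_r -catA => /(congr1 (drop (size u))).
  by rewrite !drop_size_cat.
have def_u : u = r ++ drop (size r) u.
  have := congr1 (take (size r)) def_uv.
  by rewrite take_size_cat // takel_cat ?(ltnW lt_ru) // => {1}->; rewrite cat_take_drop.
have [||r1 [r2 [j [-> r1_neq0 -> lt_jn]]]] := IHn (drop (size r) u).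
- move: def_uv; rewrite {1}def_u -catA => /(congr1 (drop (size r))).
  by rewrite !drop_size_cat.
- by move/(congr1 size)/eqP; rewrite size_drop subn_eq0 leqNgt lt_ru.
by exists r1, r2, j; split=> //; exact: ltnW.
Qed.

Definition primitive c := forall r m, c = wpow r m -> m = 1%N.

Lemma primitive_root r : r <> [::] ->
  exists rho k, primitive rho /\ r = wpow rho k.
Proof.
move: {2}(size r).+1 (ltnSn (size r)) => N; elim: N => // N IHN in r *.
move=> lt_N r_neq0; have [prim_r|] := pselect (primitive r).
  by exists r, 1%N; rewrite wpow1.
move/existsNP=> [s /existsNP[k /not_implyP[def_r k_neq1]]].
case: k => [|[|k]] // in def_r k_neq1 *.
have s_neq0 : s <> [::].
  by move=> s0; apply: r_neq0; apply: size0nil; rewrite def_r size_wpow s0 muln0.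
have [|rho [j [prim_rho def_s]]] := IHN s _ s_neq0.
  rewrite -ltnS; apply: leq_trans lt_N.
  rewrite ltnS def_r size_wpow -[ltnLHS]mul1n ltn_mul2r.
  by case: (s) s_neq0.
by exists rho, (j * k.+2)%N; rewrite wpowM -def_s.
Qed.

End WordPowers.

(** * Reduced words over a family of groups *)

Section ReducedWords.
Variables (I : Type) (A : I -> groupType).

Definition letter := {i : I & A i}.
Implicit Types (x y z : letter) (u v w : seq letter).

Definition differ x y := ~~ `[< tag x = tag y >].

Definition reduced w := all (fun x => tagged x != 1) w && sorted differ w.

(** Reducedness of the square says at once that [w] is reduced and that its
    last and first letters lie in different factors; in particular a single
    letter is not cyclically reduced. *)
Definition cyc_reduced w := w <> [::] /\ reduced (w ++ w).

Definition linv x : letter := Tagged A (tagged x)^-1.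

Definition winv w := rev [seq linv x | x <- w].

Lemma linvK : involutive linv.
Proof. by case=> i a; rewrite /linv /= invgK. Qed.

Lemma reduced_cons x y v :
  reduced (x :: y :: v) = [&& tagged x != 1, differ x y & reduced (y :: v)].
Proof. by rewrite /reduced /=; do !case: (_ != 1); case: differ; rewrite ?andbF. Qed.

Lemma reduced_head x z u :
  tag z = tag x -> tagged z <> 1 -> reduced (x :: u) -> reduced (z :: u).
Proof.
move=> tag_z /eqP z_neq1; rewrite /reduced /= z_neq1 /=.
case: u => [//|y u] /= /andP[/andP[_ ->] /andP[xy ->]].
by move: xy; rewrite /differ tag_z => ->.
Qed.

Lemma reduced_cat_cons u x y v : reduced (rcons u x ++ y :: v) =
  [&& reduced (rcons u x), reduced (y :: v) & differ x y].
Proof.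
rewrite /reduced all_cat cat_rcons sorted_cat_cons /=.
by case: (all _ (rcons u x)); case: (_ != 1); case: (all _ v);
   case: sorted; case: path; case: differ.
Qed.

Lemma reduced_catl u v : reduced (u ++ v) -> reduced u.
Proof.
by rewrite /reduced all_cat => /andP[/andP[-> _]] /cat_sorted2[-> _].
Qed.

Lemma reduced_catr u v : reduced (u ++ v) -> reduced v.
Proof.
by rewrite /reduced all_cat => /andP[/andP[_ ->]] /cat_sorted2[_ ->].
Qed.

Lemma differ_sym x y : differ x y = differ y x.
Proof. by congr (~~ _); apply/asboolP/asboolP => ->. Qed.

Lemma reduced_winv w : reduced (winv w) = reduced w.
Proof.
rewrite /reduced /winv all_rev rev_sorted all_map sorted_map.
congr (_ && _); first by apply: eq_all => x; rewrite /= invg_eq1.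
by apply: eq_sorted => x y; exact: differ_sym.
Qed.

Lemma winv_cat u v : winv (u ++ v) = winv v ++ winv u.
Proof. by rewrite /winv map_cat rev_cat. Qed.

Lemma winvK : involutive winv.
Proof.
move=> w; rewrite /winv map_rev revK -map_comp.
by rewrite -[RHS]map_id; apply: eq_map => x; exact: linvK.
Qed.

Lemma winv_wpow w n : winv (wpow w n) = wpow (winv w) n.
Proof. by elim: n => // n IHn; rewrite wpowS winv_cat IHn wpowSr. Qed.

Lemma cyc_reduced_winv w : cyc_reduced w -> cyc_reduced (winv w).
Proof.
case=> w_neq0 red; split; last by rewrite -winv_cat reduced_winv.
by move=> /(congr1 winv); rewrite winvK.
Qed.

Lemma reduced_glue u v w :
  v <> [::] -> reduced (u ++ v) -> reduced (v ++ w) -> reduced (u ++ v ++ w).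
Proof.
case/lastP: v => // v x _; case: w => [|y w]; first by rewrite cats0.
rewrite catA -rcons_cat !reduced_cat_cons.
by move=> -> /and3P[_ -> ->].
Qed.

Lemma cyc_reduced_wpow w n : cyc_reduced w -> reduced (wpow w n).
Proof.
case=> w_neq0 red; elim: n => [//|[|n] IHn].
  by rewrite wpow1; exact: reduced_catl red.
by rewrite !wpowS; exact: reduced_glue.
Qed.

Lemma cyc_reduced_wpowS w n : cyc_reduced w -> cyc_reduced (wpow w n.+1).
Proof.
move=> cyc_w; split; last by rewrite -wpowD; exact: cyc_reduced_wpow.
by case: cyc_w; case: (w).
Qed.

Lemma cyc_reduced_ends w : cyc_reduced w ->
  exists x u y, w = x :: rcons u y /\ differ x y.
Proof.
case: w => [[]//|x w [_]]; case/lastP: w => [|u y].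
  by rewrite /= reduced_cons [differ x x]/differ asboolT // andbF.
rewrite -{1}rcons_cons reduced_cat_cons => /and3P[_ _ yx].
by exists x, u, y; rewrite differ_sym.
Qed.

Lemma cyc_reduced_root r n : cyc_reduced (wpow r n) -> cyc_reduced r.
Proof.
case: n => [[]//|n] [rn_neq0].
rewrite -wpowD addSn addnS -addn2 addnC wpowD => /reduced_catl.
rewrite wpowS wpow1; split=> // r0.
by apply: rn_neq0; rewrite r0; elim: n.
Qed.

Section Evaluation.
Variables (G : groupType) (iota : forall i, {hom A i -> G}).

Definition eval w := \prod_(x <- w) iota (tag x) (tagged x).

Lemma eval_cons x w : eval (x :: w) = iota (tag x) (tagged x) * eval w.
Proof. exact: big_cons. Qed.

Lemma eval1 x : eval [:: x] = iota (tag x) (tagged x).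
Proof. exact: big_seq1. Qed.

Lemma eval_cat u v : eval (u ++ v) = eval u * eval v.
Proof. exact: big_cat. Qed.

Lemma eval_winv w : eval (winv w) = (eval w)^-1.
Proof.
elim: w => [|x w IHw]; first by rewrite /eval !big_nil invg1.
rewrite -cat1s winv_cat !eval_cat IHw invgM !eval1 /=.
by rewrite gmulfV.
Qed.

Lemma eval_wpow w n : eval (wpow w n) = eval w ^+ n.
Proof.
elim: n => [|n IHn]; first by rewrite /eval big_nil.
by rewrite wpowS eval_cat IHn expgS.
Qed.

(** The last clause serves when the merged letter is trivial, that is, when
    the two letters cancel. *)
Lemma merge_letters x y : ~~ differ x y -> exists z,
  [/\ tag z = tag x, eval [:: z] = eval [:: x; y]
    & tagged z = 1 -> x = linv y].
Proof.
case: x y => [i a] [j b] /negPn/asboolP /= ij; subst j.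
exists (existT A i (a * b)); split=> //=.
  by rewrite eval1 eval_cons eval1 /= gmulfM.
by rewrite /linv /= => /mulg1_eq <-; rewrite invgK.
Qed.

(** Conjugation by the last letter brings it next to the first one, which
    shortens a reduced word that is not cyclically reduced. *)
Lemma cyclic_merge x u y : ~~ differ y x -> exists z,
  [/\ tag z = tag x & eval (x :: rcons u y) = eval (z :: u) ^ eval [:: y]].
Proof.
move=> nyx; have [z [tag_z ev_z _]] := merge_letters nyx.
exists z; split; first by rewrite tag_z; move/negPn/asboolP: nyx.
rewrite -[z :: u]cat1s eval_cat ev_z conjgE -(cats1 u).
rewrite !eval_cons eval_cat eval1 [eval [::]]big_nil !mulg1.
by rewrite !mulgA mulVg mul1g.
Qed.

Lemma shorten_word w : ~~ reduced w ->
  exists w', (size w' < size w)%N /\ eval w' = eval w.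
Proof.
elim: w => [//|x w IHw] nred.
have [red_w|/IHw[w' [lt_w' ev_w']]] := boolP (reduced w).
  have [x1|x_neq1] := eqVneq (tagged x) 1.
    by exists w; rewrite eval_cons x1 gmulf1 mul1g.
  case: w => [|y w] in nred red_w {IHw} *.
    by rewrite /reduced /= x_neq1 in nred.
  move: nred; rewrite reduced_cons x_neq1 red_w andbT /=.
  case/merge_letters=> z [_ ev_z _].
  by exists (z :: w); rewrite -[z :: w]cat1s eval_cat ev_z -eval_cat.
by exists (x :: w'); rewrite !eval_cons ev_w'.
Qed.

Lemma reduced_form w :
  exists w', [/\ reduced w', eval w' = eval w & (size w' <= size w)%N].
Proof.
move: {2}(size w).+1 (ltnSn (size w)) => N; elim: N => // N IHN in w *.
move=> lt_N; have [red_w|/shorten_word[w1 [lt_w1 <-]]] := boolP (reduced w).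
  by exists w.
have [|w' [red_w' ev_w' le_w']] := IHN w1; first exact: leq_trans lt_w1 lt_N.
by exists w'; split=> //; exact: leq_trans le_w' (ltnW lt_w1).
Qed.

End Evaluation.
End ReducedWords.

(** * Lifting homomorphisms of a free product to wreath products *)

Section FreeProduct.
Variables (I : Type) (A : I -> groupType) (G : groupType).
Variable iota : forall i : I, {hom A i -> G}.
Hypothesis freeG : free_product iota.
Local Notation ev := (eval iota).

Lemma hom_ext (T : groupType) (f h : {hom G -> T}) :
  (forall i a, f (iota i a) = h (iota i a)) -> f =1 h.
Proof.
move=> fh; have [h0 _ uniq] := freeG (fun i => h \o iota i).
by move=> g; rewrite (uniq f) // (uniq h).
Qed.

(** The universal property maps [G] to the subgroup of values of words; followed
    by the inclusion this is the identity, by uniqueness. *)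
Lemma word_of (g : G) : exists w, ev w = g.
Proof.
pose S : pred G := fun g => `[< exists w, ev w = g >].
have closedS : group_closed S.
  split=> [|x y /asboolP[u <-] /asboolP[v <-]]; apply/asboolP.
    by exists [::]; rewrite /eval big_nil.
  by exists (u ++ winv v); rewrite eval_cat eval_winv.
have Siota i a : S (iota i a).
  by apply/asboolP; exists [:: existT A i a]; rewrite eval1.
have [h h_iota _] := freeG (fun i => corestriction closedS (Siota i)).
have id_h : idfun =1 (val : subgroup_of closedS -> G) \o h.
  by apply: hom_ext => i a; rewrite /= h_iota.
by have /asboolP := valP (h g); rewrite -[val (h g)]id_h.
Qed.

Lemma retraction (i : I) : exists r : {hom G -> A i}, cancel (iota i) r.
Proof.
pose f j : {hom A j -> A i} :=
  if pselect (j = i) is left e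
  then let: erefl in _ = k := e return {hom A j -> A k} in idfun
  else one_fun (A i).
have [r r_iota _] := freeG f; exists r => a; rewrite r_iota /f.
by case: pselect => // e; rewrite (Prop_irrelevance e erefl).
Qed.

(** The factor of [x] is sent to the complement twisted by a function
    supported at [1], the other factors to the standard complement.  Each letter
    of the word contributes the values of its twisting function at the two ends
    of a step of the path traced by the suffixes; all of them are trivial except
    at the very start, because no inner vertex of the path is [1] and because
    [y], whose step ends at [1], is not twisted there. *)
Lemma wreath_lift (K L : groupType) (phi : {hom G -> L}) (k : K) x u y :
  differ x y -> phi (ev (x :: rcons u y)) = 1 ->
  (forall v1 v2, rcons u y = v1 ++ v2 -> v2 <> [::] -> phi (ev v2) <> 1) ->
  exists psi : {hom G -> wreath K L},
    (forall g, wtop (psi g) = phi g)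
    /\ wbase (psi (ev (x :: rcons u y))) 1 = k.
Proof.
move=> xy phi_w phi_suffix.
(* The contribution of the first letter is the inverse of [f (tag x) 1]. *)
pose f i (t : L) : K := if `[< i = tag x /\ t = 1 >] then k^-1 else 1.
have fV i t : f i t^-1 = f i t.
  congr (if _ then _ else _); apply/asboolP/asboolP => -[-> /eqP].
    by rewrite invg_eq1 => /eqP.
  by move/eqP->; rewrite invg1.
have f_neq1 i t : t <> 1 -> f i t = 1.
  by move=> t1; rewrite /f; case: asboolP => // -[].
have [psi psi_iota _] := freeG (fun i => twisted_top (f i) \o (phi \o iota i)).
have psi_letter i a : psi (iota i a) = Wreath (phi (iota i a))
    (fun t => (f i (t * (phi (iota i a))^-1))^-1 * f i t).
  by rewrite psi_iota; exact: twisted_topE.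
have psi_top : (@wtop K L) \o psi =1 phi.
  by apply: hom_ext => i a; rewrite /= psi_letter.
exists psi; split=> //.
have baseE z v : wbase (psi (ev (z :: v))) 1 =
    (f (tag z) (phi (ev (z :: v))))^-1 * f (tag z) (phi (ev v))
    * wbase (psi (ev v)) 1.
  rewrite eval_cons gmulfM /= /translate mul1g.
  have -> : wtop (psi (ev v)) = phi (ev v) by exact: psi_top.
  rewrite psi_letter /= -invgM -gmulfM.
  by rewrite !fV.
have base_suffix v2 : forall v1, rcons u y = v1 ++ v2 ->
    wbase (psi (ev v2)) 1 = 1.
  elim: v2 => [|z v IHv] v1 def_uy; first by rewrite /eval big_nil gmulf1.
  rewrite baseE (IHv (rcons v1 z)) ?cat_rcons // mulg1.
  rewrite f_neq1 ?invg1 ?mul1g; last exact: phi_suffix def_uy _.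
  case: v => [|z' v] in def_uy {IHv} *; last first.
    by apply: f_neq1; apply: (phi_suffix (rcons v1 z)) => //; rewrite cat_rcons.
  move: def_uy; rewrite cats1 => /rcons_inj[_ <-]; rewrite /f.
  by case: asboolP => // -[yx]; case/asboolP: xy.
rewrite baseE (base_suffix _ [::]) // mulg1 phi_w.
rewrite [f _ (phi _)]f_neq1 ?mulg1; last first.
  by apply: (phi_suffix [::]) => //; case: (u).
by rewrite /f asboolT // invgK.
Qed.

(** * Normal forms, and residuality of the free product *)

Section RootClass.
Variable C : groupType -> Prop.
Hypotheses (rootC : root_class C) (resA : forall i, residually C (A i)).

(** Induction on the length.  A single letter is detected in its factor through
    the retraction.  If the end letters lie in different factors, one
    homomorphism detects all proper suffixes, and either it detects the word or
    [wreath_lift] applies.  Otherwise a cyclic rotation shortens the word. *)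
Lemma reduced_detected w : reduced w -> w <> [::] -> detected C (ev w).
Proof.
move: {2}(size w).+1 (ltnSn (size w)) => N; elim: N => // N IHN in w *.
case: w => [//|x w] /=; rewrite ltnS => lt_N red_w _.
case/lastP: w => [|u y] in lt_N red_w *.
  have [r rK] := retraction (tag x).
  have [|K [f [CK fx]]] := @residually_detected C _ (tagged x) (@resA _).
    by apply/eqP; case/andP: red_w; case/andP.
  by exists K, (f \o r); rewrite eval1 /= rK.
have [xy|nxy] := boolP (differ x y).
  have [|K [phi [CK phi_suffix]]] :=
      @detected_all C rootC _
        [seq ev (drop n (rcons u y)) | n <- seq.iota 0 (size (rcons u y))].
    move=> g /mapP[n + ->]; rewrite mem_iota add0n => /andP[_ lt_n]; apply: IHN.
    - by rewrite size_drop; exact: leq_ltn_trans (leq_subr _ _) lt_N.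
    - apply: (@reduced_catr _ _ (x :: take n (rcons u y))).
      by rewrite cat_cons cat_take_drop.
    - by move/(congr1 size)/eqP; rewrite size_drop subn_eq0 leqNgt lt_n.
  have suffix v1 v2 : rcons u y = v1 ++ v2 -> v2 <> [::] -> phi (ev v2) <> 1.
    move=> def_uy v2_neq0; apply: phi_suffix; apply/mapP; exists (size v1).
      rewrite mem_iota def_uy size_cat -[ltnLHS]addn0 ltn_add2l.
      by case: (v2) v2_neq0.
    by rewrite def_uy drop_size_cat.
  have [phi_w|] := pselect (phi (ev (x :: rcons u y)) = 1); last by exists K, phi.
  case: rootC => _ [X CX [k k_neq1]] _ wrC.
  have [psi [_ psi_w]] := wreath_lift k xy phi_w suffix.
  exists (wreath X K), psi; split=> [|psi1]; first exact: wrC.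
  by apply: k_neq1; rewrite -psi_w psi1.
have [|z [tag_z ->]] := @cyclic_merge _ _ _ iota x u y.
  by rewrite differ_sym.
apply: detected_conj.
have red_xu : reduced (x :: u).
  by move: red_w; rewrite -rcons_cons -cats1; exact: reduced_catl.
rewrite size_rcons in lt_N.
have [z1|z_neq1] := pselect (tagged z = 1); last first.
  by apply: IHN => //; exact: reduced_head red_xu.
rewrite eval_cons z1 gmulf1 mul1g; apply: IHN; first exact: ltnW.
  by apply: (@reduced_catr _ _ [:: x]).
move=> u0; move: red_w nxy; rewrite u0 /reduced /= => /andP[_].
by rewrite andbT => ->.
Qed.
Lemma reduced_neq1 w : reduced w -> w <> [::] -> ev w <> 1.
Proof.
move=> red_w w_neq0 w1; have [K [f [_]]] := reduced_detected red_w w_neq0.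
by rewrite w1 gmulf1.
Qed.

(** Comparing first letters of [u] and [v], a difference would leave a nonempty
    reduced word for [u^-1 * v = 1]. *)
Lemma reduced_inj u v : reduced u -> reduced v -> ev u = ev v -> u = v.
Proof.
have ev0 : ev [::] = 1 by exact: big_nil.
elim: u v => [|x u IHu] [|y v] // red_u red_v uv.
- by case: (reduced_neq1 red_v) => //; rewrite -uv.
- by case: (reduced_neq1 red_u) => //; rewrite uv.
have winv_xu : winv (x :: u) = rcons (winv u) (linv x).
  by rewrite /winv /= rev_cons.
have [xy|nxy] := boolP (differ x y).
  case: (@reduced_neq1 (winv (x :: u) ++ y :: v)).
  - by rewrite winv_xu reduced_cat_cons -winv_xu reduced_winv red_u red_v.
  - by move/(congr1 size)/eqP; rewrite size_cat addnS.
  - by rewrite eval_cat eval_winv uv mulVg.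
(* The letters [x^-1] and [y] merge; they must cancel, since otherwise the
   word around the merged letter would be reduced. *)
have [z [tag_z ev_z z1]] := merge_letters iota (nxy : ~~ differ (linv x) y).
have ev_zv : ev (winv u ++ z :: v) = 1.
  rewrite eval_cat -[z :: v]cat1s eval_cat ev_z -eval_cat /= eval_cons.
  by rewrite -uv eval_cons /= gmulfV mulKg eval_winv mulVg.
have [/z1/(can_inj (@linvK _ _)) x_y|z_neq1] := pselect (tagged z = 1).
  rewrite x_y; congr cons; apply: IHu; first exact: (@reduced_catr _ _ [:: x]).
    exact: (@reduced_catr _ _ [:: y]).
  by move: uv; rewrite !eval_cons x_y => /mulgI.
case: (@reduced_neq1 (winv u ++ [:: z] ++ v)) => //; last first.
  by move/(congr1 size)/eqP; rewrite size_cat addnS.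
apply: reduced_glue => //.
  rewrite cats1 -(linvK z).
  rewrite (_ : rcons _ _ = winv (linv z :: u)); last by rewrite /winv /= rev_cons.
  rewrite reduced_winv; apply: reduced_head red_u => //.
  by move=> /= /eqP; rewrite invg_eq1 => /eqP.
apply: reduced_head red_v => //.
by rewrite tag_z; move/negPn/asboolP: nxy.
Qed.

(** The word [w] shortens to a reduced word, which by uniqueness is [v]. *)
Lemma reduced_minimal v w : reduced v -> ~~ reduced w -> ev v = ev w ->
  (size v < size w)%N.
Proof.
move=> red_v /(shorten_word iota)[w1 [lt_w1 <-]] vw1.
have [w2 [red_w2 ev_w2 le_w2]] := reduced_form iota w1.
rewrite (reduced_inj red_v red_w2) ?vw1 ?ev_w2 //.
exact: leq_ltn_trans le_w2 lt_w1.
Qed.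

Lemma residually_free_product : residually C G.
Proof.
apply: (detected_residually rootC) => g.
have [w0 <-] := word_of g; have [w [red_w <- _]] := reduced_form iota w0.
case: w => [|x w] in red_w *; first by rewrite /eval big_nil.
by move=> _; exact: reduced_detected.
Qed.

(** Repeated shortening, by reduction or by a cyclic rotation, of a word
    representing [g] up to conjugacy. *)
Lemma conjugate_normal_form (g : G) :
  [\/ g = 1, exists i a y, g = iota i a ^ y
    | exists c y, cyc_reduced c /\ g = ev c ^ y].
Proof.
suff nf w y : [\/ ev w ^ y = 1, exists i a z, ev w ^ y = iota i a ^ z
    | exists c z, cyc_reduced c /\ ev w ^ y = ev c ^ z].
  by have [w <-] := word_of g; have := nf w 1; rewrite conjg1.
move: {2}(size w).+1 (ltnSn (size w)) => N; elim: N => // N IHN in w y *.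
rewrite ltnS => lt_N.
have [red_w|/(shorten_word iota)[w' [lt_w' <-]]] := boolP (reduced w).
  2: by apply: IHN; exact: leq_trans lt_w' lt_N.
case: w => [|x w] in lt_N red_w *.
  by constructor 1; rewrite /eval big_nil conj1g.
case/lastP: w => [|u z] in lt_N red_w *.
  by constructor 2; exists (tag x), (tagged x), y; rewrite eval1.
have [zx|/(cyclic_merge iota u)[t [_ ->]]] := boolP (differ z x).
  constructor 3; exists (x :: rcons u z), y; split=> //; split=> //.
  rewrite -{1}rcons_cons reduced_cat_cons zx !andbT.
  by rewrite rcons_cons red_w.
rewrite -conjgM; apply: IHN; apply: leq_trans lt_N.
by rewrite /= size_rcons.
Qed.

(** If [h] commutes with [c], lengths forbid cancellation at exactly one of the
    two junctions of [c h] and [h c].  Cancellation at neither makes [c ++ h]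
    and [h ++ c] equal normal forms; cancellation at both means that there is
    none between [h] and [c^-1].  In either case the words themselves commute
    and have a common root. *)
Lemma commuting_root c h : cyc_reduced c -> reduced h ->
  commute (ev c) (ev h) ->
  exists r m n, h = wpow r n /\ (c = wpow r m \/ winv c = wpow r m).
Proof.
move=> cyc_c red_h ch.
suff [eq_ch|eq_ch] : c ++ h = h ++ c \/ winv c ++ h = h ++ winv c.
- by have [r [m [n [-> ->]]]] := commuting_words eq_ch; exists r, m, n; split=> //; left.
- by have [r [m [n [-> ->]]]] := commuting_words eq_ch; exists r, m, n; split=> //; right.
have red_c : reduced c by case: cyc_c => _; exact: reduced_catl.
have ev_ch : ev (c ++ h) = ev (h ++ c) by rewrite !eval_cat.
case: (posnP (size h)) => [/size0nil->|h_gt0]; first by left; rewrite cats0.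
have [x [u [e [def_c xe]]]] := cyc_reduced_ends cyc_c.
have [y [h1 def_h1]] : exists y h1, h = y :: h1.
  by case: (h) h_gt0 => // y h1 _; exists y, h1.
have [z [h2 def_h2]] : exists z h2, h = rcons h2 z.
  by case/lastP: (h) h_gt0 => // h2 z _; exists z, h2.
have red_ch : reduced (c ++ h) = differ e y.
  rewrite def_c def_h1 -rcons_cons reduced_cat_cons rcons_cons -def_c -def_h1.
  by rewrite red_c red_h.
have red_hc : reduced (h ++ c) = differ z x.
  rewrite def_c def_h2 reduced_cat_cons -def_c -def_h2.
  by rewrite red_c red_h.
have [ey|ney] := boolP (differ e y); have [zx|nzx] := boolP (differ z x).
- by left; apply: reduced_inj; rewrite ?red_ch ?red_hc.
- suff: (size (c ++ h) < size (h ++ c))%N by rewrite !size_cat addnC ltnn.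
  by apply: reduced_minimal; rewrite ?red_ch ?red_hc.
- suff: (size (h ++ c) < size (c ++ h))%N by rewrite !size_cat addnC ltnn.
  by apply: reduced_minimal; rewrite ?red_ch ?red_hc.
right; have def_c1 : winv c = rcons (linv e :: winv u) (linv x).
  by rewrite def_c /winv /= map_rcons rev_cons rev_rcons.
have same_ey : tag e = tag y by move/negPn/asboolP: ney.
have same_zx : tag z = tag x by move/negPn/asboolP: nzx.
have red_c1 : reduced (winv c) by rewrite reduced_winv.
apply: reduced_inj; last first.
- by rewrite !eval_cat eval_winv; apply/commute_sym/commuteV/commute_sym.
- rewrite def_h2 def_c1 rcons_cons reduced_cat_cons -rcons_cons -def_c1 -def_h2.
  by rewrite red_h red_c1 /differ /= same_zx.
- rewrite def_h1 def_c1 reduced_cat_cons -def_c1 -def_h1.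
  by rewrite red_h red_c1 /differ /= -same_ey.
Qed.

(** * Orders of images of a primitive word *)

(** Otherwise [c] or its inverse and [v] would be powers of one word, which by
    primitivity is as long as [c]; but [v] is shorter and nonempty. *)
Lemma primitive_suffix_commute c u v : cyc_reduced c -> primitive c ->
  c = u ++ v -> u <> [::] -> v <> [::] -> ~ commute (ev c) (ev v).
Proof.
move=> cyc_c prim_c def_c u_neq0 v_neq0 cv.
have red_v : reduced v.
  by apply: (@reduced_catr _ _ u); rewrite -def_c; case: cyc_c => _ /reduced_catl.
have lt_vc : (size v < size c)%N.
  by rewrite def_c size_cat -[ltnLHS]add0n ltn_add2r; case: (u) u_neq0.
have [r [m [n [def_v def_r]]]] := commuting_root cyc_c red_v cv.
have m1 : m = 1%N.
  case: def_r => [/prim_c // | /(congr1 (@winv _ _))].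
  by rewrite winvK winv_wpow => /prim_c.
have size_r : size r = size c.
  by case: def_r; rewrite m1 wpow1 => <-; rewrite // size_rev size_map.
move: v_neq0 lt_vc; rewrite def_v size_wpow size_r.
by case: n {def_v} => // n _; rewrite mulSn ltnNge leq_addr.
Qed.

(** Induction on [k], along homomorphisms [f] that also keep [c] from commuting
    with its proper suffixes.  If the image of [c] has finite order [N], the
    word [c^N] meets the conditions of [wreath_lift]: a proper suffix [v c^j]
    with trivial image would make the image of [v] commute with that of [c], or
    contradict the minimality of [N].  Prescribing a value whose order is
    infinite or divisible by [p] then brings a further factor [p] into the
    order, or makes it infinite. *)
Lemma power_detected c p k : cyc_reduced c -> primitive c -> prime_set C p ->
  exists (K : groupType) (f : {hom G -> K}),
    C K /\ forall t, f (ev c) ^+ t = 1 -> (p ^ k %| t)%N.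
Proof.
move=> cyc_c prim_c Cp.
suff [K [f [CK _ ordf]]] : exists (K : groupType) (f : {hom G -> K}),
    [/\ C K, forall u v, c = u ++ v -> u <> [::] -> v <> [::] ->
               f [~ ev c, ev v] <> 1
      & forall t, f (ev c) ^+ t = 1 -> (p ^ k %| t)%N] by exists K, f.
elim: k => [|k [K [f [CK f_comm ordf]]]].
  have [g|K [f [CK f_comm]]] := @detected_all C rootC G
      [seq [~ ev c, ev (drop n c)] | n <- seq.iota 1 (size c).-1].
    move=> /mapP[n]; rewrite mem_iota => /andP[n_gt0 lt_n] ->.
    have {}lt_n : (n < size c)%N.
      by move: n_gt0 lt_n; rewrite add1n; case: (size c) => //; case: (n).
    apply: residually_detected residually_free_product _ => /eqP/commgP.
    apply: (@primitive_suffix_commute c (take n c)) => //.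
    - by rewrite cat_take_drop.
    - by move/(congr1 size)/eqP; rewrite size_take lt_n; case: (n) n_gt0.
    - by move/(congr1 size)/eqP; rewrite size_drop subn_eq0 leqNgt lt_n.
  exists K, f; split=> // u v def_c u_neq0 v_neq0.
  apply: f_comm; apply/mapP; exists (size u); last by rewrite def_c drop_size_cat.
  rewrite mem_iota def_c size_cat.
  case: (u) (v) u_neq0 v_neq0 => [|x u'] [|y v'] // _ _ /=.
  by rewrite add1n !addnS !ltnS leq_addr.
have [[t [t_gt0 ft]]|inf] := pselect (exists t, (0 < t)%N /\ f (ev c) ^+ t = 1); last first.
  exists K, f; split=> // t ft; case: (posnP t) => [->|t_gt0]; first exact: dvdn0.
  by case: inf; exists t.
have [N ordN] := has_order_ex t_gt0 ft; have [N_gt0 fN minN] := ordN.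
have [X [k0 [CX ord_k0]]] : exists (X : groupType) (k0 : X),
    C X /\ forall t, k0 ^+ t = 1 -> (p %| t)%N.
  case: Cp => _ [[X CX /existsNP[k0 inf]] | [X [k0 [n [CX ord_n pn]]]]]; exists X, k0.
    split=> // s k0s; case: (posnP s) => [->|s_gt0]; first exact: dvdn0.
    by case: inf; exact: has_order_ex s_gt0 k0s.
  by split=> // s /(has_order_dvd ord_n); exact: dvdn_trans.
have [x [u [y [def_w xy]]]] : exists x u y, wpow c N = x :: rcons u y /\ differ x y.
  by case: (N) N_gt0 => // n _; exact/cyc_reduced_ends/cyc_reduced_wpowS.
have [| v1 v2 def_v v2_neq0 | psi [psi_top psi_w]] :=
    @wreath_lift X K f k0 x u y xy.
- by rewrite -def_w eval_wpow gmulfXn.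
- have [|//|r1 [r2 [j [def_c r1_neq0 def_v2 lt_jN]]]] :=
      @wpow_suffix _ c N (x :: v1) v2.
    by rewrite def_w def_v.
  rewrite def_v2 eval_cat eval_wpow gmulfM gmulfXn => fv2.
  have [r2_0|r2_neq0] := pselect (r2 = [::]).
    move: fv2; rewrite r2_0 /eval big_nil gmulf1 mul1g -/(eval iota c) => fj.
    case: (posnP j) => [j0|j_gt0]; first by case: v2_neq0; rewrite def_v2 r2_0 j0.
    by move: lt_jN; rewrite ltnNge minN.
  apply: (f_comm r1 r2) => //; rewrite gmulfR; apply/eqP/commgP.
  have -> : f (ev r2) = (f (ev c) ^+ j)^-1 by apply/eqP; rewrite -mulg_eq1 fv2.
  exact/commuteV/commuteX/commute_refl.
exists (wreath X K), psi; split.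
- by case: rootC => _ _ _; exact.
- move=> r1 r2 def_c r1_neq0 r2_neq0 psi1; apply: (f_comm r1 r2) => //.
  by rewrite -psi_top psi1.
move=> s psis; have /(has_order_dvd ordN)/dvdnP[q def_s] : f (ev c) ^+ s = 1.
  by rewrite -gmulfXn -psi_top gmulfXn psis.
have psiN : psi (ev c) ^+ N = psi (ev (x :: rcons u y)).
  by rewrite -gmulfXn -eval_wpow def_w.
have pq : (p %| q)%N.
  apply: ord_k0; rewrite -psi_w -wreath_exp_base -psiN.
    by rewrite -expgnA mulnC -def_s psis.
  by rewrite -gmulfXn psi_top gmulfXn.
by rewrite def_s expnS; apply: dvdn_mul => //; exact: ordf.
Qed.

(** * Separability of cyclic subgroups *)

Lemma cyc_reduced_order c m n : cyc_reduced c ->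
  ev c ^+ m = ev c ^+ n -> m = n.
Proof.
move=> cyc_c; rewrite -!eval_wpow => /reduced_inj.
move=> /(_ (cyc_reduced_wpow _ cyc_c) (cyc_reduced_wpow _ cyc_c)).
move/(congr1 size)/eqP; rewrite !size_wpow eqn_pmul2r; first by move/eqP.
by case: cyc_c; case: (c).
Qed.

(** A prime power [p^k] divides [M] but not [n].  If [p] were outside the prime
    set, isolation would put [c^(M/p)] into the infinite cyclic group generated
    by [c^M]. *)
Lemma primitive_powers_separated c M n : cyc_reduced c -> primitive c ->
  (0 < M)%N -> isolated C (cyclic_gen (ev c ^+ M)) ->
  ~ cyclic_gen (ev c ^+ M) (ev c ^+ n) ->
  exists (K : groupType) (f : {hom G -> K}),
    C K /\ ~ (f @` cyclic_gen (ev c ^+ M)) (f (ev c ^+ n)).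
Proof.
move=> cyc_c prim_c M_gt0 iso_cM not_cn.
have [p pi_p] : exists2 p, p \in \pi(M) & ~~ (p ^ logn p M %| n)%N.
  apply: contrapT => nex; apply: not_cn.
  have /dvdnP[q ->] : (M %| n)%N.
    apply/dvdn_partP => // p pi_p; rewrite p_part; apply/negPn/negP => nd.
    by apply: nex; exists p.
  by exists q; left; rewrite -expgnA mulnC.
set k := logn p M => nmid.
have [pr_p _ p_dvd_M] : [/\ prime p, (0 < M)%N & (p %| M)%N].
  by move: pi_p; rewrite mem_primes => /and3P[].
have Cp : prime_set C p.
  apply: contrapT => nCp.
  have [] := iso_cM (ev c ^+ (M %/ p)) p pr_p nCp.
    by exists 1%N; left; rewrite -expgnA divnK.
  have M'_gt0 : (0 < M %/ p)%N.
    by rewrite (divn_gt0 _ (prime_gt0 pr_p)) (dvdn_leq M_gt0 p_dvd_M).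
  move=> j []; rewrite -expgnA.
    move/(cyc_reduced_order cyc_c)/eqP; case: j => [|j]; first by rewrite muln0 gtn_eqF.
    rewrite mulnS ltn_eqF // ltn_addr //; apply: ltn_Pdiv => //; exact: prime_gt1.
  move/eqP; rewrite -mulg_eq1 -expgnDr => /eqP/(@cyc_reduced_order c _ 0%N cyc_c)/eqP.
  by rewrite addn_eq0 gtn_eqF.
have [K [f [CK ordf]]] := power_detected k cyc_c prim_c Cp.
have p_dvd_Mj j : (p ^ k %| M * j)%N by apply/dvdn_mulr/pfactor_dvdnn.
exists K, f; split=> // -[_ [j [-> | ->]]]; rewrite -expgnA ?gmulfV !gmulfXn => fj.
  have [le_nM|/ltnW le_Mn] := leqP n (M * j).
    have /ordf : f (ev c) ^+ (M * j - n) = 1 by rewrite expgnFr // fj mulgV.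
    by rewrite dvdn_subr // (negPf nmid).
  have /ordf : f (ev c) ^+ (n - M * j) = 1 by rewrite expgnFr // fj mulgV.
  by rewrite dvdn_subl // (negPf nmid).
have /ordf : f (ev c) ^+ (M * j + n) = 1 by rewrite expgnDr -fj mulgV.
by rewrite dvdn_addr // (negPf nmid).
Qed.

Lemma hyperbolic_separable c : cyc_reduced c ->
  isolated C (cyclic_gen (ev c)) -> separable C (cyclic_gen (ev c)).
Proof.
move=> cyc_c iso_c; apply: (separable_hom rootC) => g not_g.
have [cg|ncg] := pselect (commute (ev c) g); last first.
  have [|K [f [CK f_cg]]] :=
      residually_detected residually_free_product (x := [~ ev c, g]).
    by move/eqP/commgP.
  exists K, f; split=> // -[y [j def_y] fy]; apply: f_cg.
  rewrite gmulfR -fy -gmulfR; case: def_y => ->; first by rewrite commgXg gmulf1.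
  by rewrite commgXVg gmulf1.
have [w0 def_g] := word_of g; have [h [red_h ev_h _]] := reduced_form iota w0.
rewrite -def_g -ev_h in cg not_g *.
have [r [m [n [def_h def_r]]]] := commuting_root cyc_c red_h cg.
have [c1 [cyc_c1 gen_c1 def_c1]] : exists c1,
    [/\ cyc_reduced c1, cyclic_gen (ev c) = cyclic_gen (ev c1) & c1 = wpow r m].
  case: def_r => ?; first by exists c.
  by exists (winv c); rewrite eval_winv cyclic_genV; split=> //; exact: cyc_reduced_winv.
have r_neq0 : r <> [::].
  by move=> r0; case: cyc_c1; rewrite def_c1 r0; elim: m {def_c1 def_r}.
have [rho [k [prim_rho def_rho]]] := primitive_root r_neq0.
have cyc_rho : cyc_reduced rho.
  by apply: (@cyc_reduced_root _ _ _ (k * m)); rewrite wpowM -def_rho -def_c1.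
have M_gt0 : (0 < k * m)%N.
  rewrite lt0n; apply/eqP => km0; case: cyc_c1.
  by rewrite def_c1 def_rho -wpowM km0.
move: iso_c not_g; rewrite gen_c1 def_c1 def_h def_rho -!wpowM !eval_wpow.
exact: primitive_powers_separated.
Qed.

Lemma factor_inj i : injective (iota i).
Proof. by have [r rK] := retraction i; exact: can_inj rK. Qed.

Lemma preimage_factor i (H : set (A i)) : iota i @^-1` (iota i @` H) = H.
Proof.
apply/seteqP; split=> [x [y Hy /factor_inj<-] // | x Hx]; exact: imageP.
Qed.

(** Elements of the factor are separated through the retraction [r].  For the
    others, some [f] tells [g] from its retraction, so [f] and its composite
    with the retraction agree on the factor but not at [g]. *)
Lemma separable_factor i (H : set (A i)) :
  separable C H -> separable C (iota i @` H).
Proof.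
move=> sepH; apply: (separable_hom rootC) => g not_g.
have [r rK] := retraction i.
have [gr|g_neq_r] := pselect (g = iota i (r g)); last first.
  have [|K [f [CK fg]]] :=
      residually_detected residually_free_product (x := g / iota i (r g)).
    by move/divg1_eq.
  exists (wreath K K), (const_wreath f (f \o (iota i \o r))); split.
    by case: rootC => _ _ _; exact.
  case=> _ [a Ha <-] e; apply: fg.
  have /= := congr1 (@wtop K K) e; rewrite rK => top_e.
  have /= base_e := congr1 (fun u => wbase u 1) e.
  by rewrite gmulfF -base_e -top_e mulgV.
have [|K [f [CK _ nHf]]] := sepH (r g).
  by move=> Hr; apply: not_g; rewrite gr; exact: imageP.
exists K, (f \o r); split=> // -[_ [a Ha <-]]; rewrite /= rK => fa.
by apply: nHf; exists a.
Qed.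

(** If [g^q] lies in the factor, then [g] and its retraction are [q]-th roots of
    the same element. *)
Lemma isolated_factor i (H : set (A i)) :
  isolated C H -> isolated C (iota i @` H).
Proof.
move=> isoH g q pr_q nCq [a Ha ag]; have [r rK] := retraction i.
have def_g : g = iota i (r g).
  apply: (unique_roots_residually residually_free_product pr_q nCq).
  by rewrite -!gmulfXn -ag rK.
rewrite def_g; apply/imageP/(isoH _ q pr_q nCq).
by rewrite -gmulfXn -ag rK.
Qed.

(** Of the three cases of [conjugate_normal_form] only a conjugate into a factor
    is compatible with defectiveness. *)
Lemma defective_cyclicP (H : set G) : cyclic_subgroup H ->
  defective C H <->
  exists (i : I) (H' : set (A i)),
    [/\ cyclic_subgroup H', defective C H' & conjugate_in H (iota i @` H')].
Proof.
case=> g ->; split=> [[iso_g nsep_g] | [i [H' [_ [iso_H' nsep_H'] conj]]]].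
  have [g1 | [i [a [y def_g]]] | [c [y [cyc_c def_g]]]] := conjugate_normal_form g.
  - by case: nsep_g; rewrite g1 cyclic_gen1; exact: residually_free_product.
  - have conj : conjugate_in (cyclic_gen g) (iota i @` cyclic_gen a).
      by rewrite def_g cyclic_gen_conj image_cyclic_gen; exists y.
    exists i, (cyclic_gen a); split; [by exists a | split | by []].
      rewrite -(preimage_factor (cyclic_gen a)); apply: isolated_preimage.
      exact: isolated_conjugate (conjugate_in_sym conj) iso_g.
    move=> sep_a; apply: nsep_g; apply: (separable_conjugate rootC conj).
    exact: separable_factor.
  - have conj : conjugate_in (cyclic_gen g) (cyclic_gen (ev c)).
      by rewrite def_g cyclic_gen_conj; exists y.
    case: nsep_g; apply: (separable_conjugate rootC conj).
    apply: hyperbolic_separable => //.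
    exact: isolated_conjugate (conjugate_in_sym conj) iso_g.
split; first by apply: isolated_conjugate conj _; exact: isolated_factor.
move=> sep_g; apply: nsep_H'; rewrite -(preimage_factor H').
apply: (separable_preimage rootC).
exact: (separable_conjugate rootC (conjugate_in_sym conj)).
Qed.

End RootClass.
End FreeProduct.

Theorem corollary2 (C : groupType -> Prop) (I : Type) (A : I -> groupType)
    (G : groupType) (iota : forall i : I, {hom A i -> G}) :
  root_class C -> free_product iota -> (forall i : I, residually C (A i)) ->
  (forall H : set G, cyclic_subgroup H ->
     (defective C H <->
      exists (i : I) (H' : set (A i)),
        [/\ cyclic_subgroup H', defective C H'
          & conjugate_in H (iota i @` H')]))
  /\
  ((forall (i : I) (H' : set (A i)),
      cyclic_subgroup H' -> isolated C H' -> separable C H') ->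
   forall H : set G,
     cyclic_subgroup H -> isolated C H -> separable C H).
Proof.
move=> rootC freeG resA; split=> [H cycH | sepA H cycH isoH].
  exact: defective_cyclicP.
apply: contrapT => nsepH.
have [+ _] := defective_cyclicP freeG rootC resA cycH.
case/(_ (conj isoH nsepH)) => i [H' [cycH' [isoH' nsepH'] _]].
by apply/nsepH'/sepA.
Qed.
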